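(* If $G$ is a subcubic graph (i.e. $G$ has maximum degree at most $3$), then $\mathrm{pind}(A_G)=1$. As a consequence, every subcubic graph is $(2,2)$-choosable.
   Context: Graphs are finite and simple. The matrix $A_G$: fix an orientation of $G$. $A_G$ is the real matrix with rows indexed by $E(G)$ and columns indexed by $V(G)\cup E(G)$, where for an edge $e$ oriented from $a$ to $b$: $A_G[e,z]=1$ if $z=b$ or $z\neq e$ is an edge incident to $b$; $A_G[e,z]=-1$ if $z=a$ or $z\ne e$ is an edge incident to $a$; and $A_G[e,z]=0$ otherwise. (Changing the orientation only multiplies rows by $-1$, so the notion below does not depend on it.) The permanent of an $m\times m$ matrix $A$ is $\mathrm{per}(A)=\sum_{\sigma\in S_m}\prod_{i=1}^m A[i,\sigma(i)]$ (the empty matrix has permanent $1$). The permanent index $\mathrm{pind}(A)$ of a matrix $A$ is the minimum positive integer $k$ such that there is a square matrix $A'$ (with the same rows as $A$) with $\mathrm{per}(A')\ne0$, each column of $A'$ is a column of $A$, and each column of $A$ (identified by its column index) occurs in $A'$ at most $k$ times; if no such $k$ exists, $\mathrm{pind}(A)=\infty$. A total weighting of $G$ is a map $f:V(G)\cup E(G)\to\mathbb{R}$; the vertex sum of $v$ is $\phi_f(v)=f(v)+\sum_{e\in E(v)}f(e)$, where $E(v)$ is the set of edges incident to $v$. It is proper if $\phi_f(u)\neq\phi_f(v)$ for every edge $uv$ of $G$. $G$ is $(k,k')$-choosable if for every assignment $L$ of a set $L(v)$ of $k$ real numbers to each vertex $v$ and a set $L(e)$ of $k'$ real numbers to each edge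 $e$, there is a proper total weighting $f$ with $f(z)\in L(z)$ for all $z\in V(G)\cup E(G)$. *)

(* Defs.v *)
(* MathComp world, with the reals of MathComp-Analysis ([R : realType]). *)
From HB Require Import structures.
From mathcomp Require Import all_boot all_order all_algebra all_fingroup finmap.
From mathcomp Require Import boolp reals.
Set Implicit Arguments.
Unset Strict Implicit.
Unset Printing Implicit Defensive.
Import Order.TTheory GRing.Theory Num.Theory.
Local Open Scope ring_scope.

Record sgraph := SGraph {
  vertex :> finType;
  adj : rel vertex;
  adj_sym : symmetric adj;
  adj_irrefl : irreflexive adj }.

Section Graph.
Variable G : sgraph.

(* An edge is the unordered pair [set x; y] of its ends, so that v is incident
   to e when v \in val e. *)
Definition edge_set : {set {set G}} :=
  [set [set xy.1; xy.2] | xy : G * G & adj xy.1 xy.2].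

Definition edge : finType := {e : {set G} | e \in edge_set}.

Definition degree (v : G) : nat := #|[set u | adj v u]|.

Definition max_degree : nat := (\max_(v : G) degree v)%N.

Definition subcubic : Prop := (max_degree <= 3)%N.

Record orientation := Orientation {
  arc_tail : edge -> G;
  arc_head : edge -> G;
  orientationP : forall e : edge, val e = [set arc_tail e; arc_head e] }.

End Graph.

Section EdgeMatrix.
Variables (R : pzRingType) (G : sgraph) (o : orientation G).

(* [inl v] is the column of the vertex v, [inr e] that of the edge e. *)
Definition incident_off (e : edge G) (z : G + edge G) (v : G) : bool :=
  match z with
  | inl u => u == v
  | inr e' => (e' != e) && (v \in val e')
  end.

(* The two tests exclude each other: the ends of e are distinct, and an edge
   incident to both of them is e. *)
Definition edge_entry (e : edge G) (z : G + edge G) : R :=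
  if incident_off e z (arc_head o e) then 1
  else if incident_off e z (arc_tail o e) then -1
  else 0.

(* Rows and columns are numbered by the canonical enumerations of the finite
   types of edges and of vertices and edges. *)
Definition edge_matrix : 'M[R]_(#|{: edge G}|, #|{: G + edge G}|) :=
  \matrix_(i, j) edge_entry (enum_val i) (enum_val j).

End EdgeMatrix.

Definition permanent (R : pzRingType) (m : nat) (A : 'M[R]_m) : R :=
  \sum_(s : 'S_m) \prod_(i < m) A i (s i).

(* Column i of A' = colsub c A is column c i of A, so column j of A occurs
   #|[set i | c i == j]| times in A'. *)
Definition pind_le (R : pzRingType) (m n : nat) (A : 'M[R]_(m, n)) (k : nat) :
  Prop :=
  exists c : 'I_m -> 'I_n,
    permanent (colsub c A) <> 0 /\
    forall j : 'I_n, (#|[set i | c i == j]| <= k)%N.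

(* [Some k] for a finite index k, [None] for infinity. *)
Definition pind (R : pzRingType) (m n : nat) (A : 'M[R]_(m, n)) : option nat :=
  match pselect (exists k : nat, (0 < k)%N && `[< pind_le A k >]) with
  | left exk => Some (ex_minn exk)
  | right _ => None
  end.

Section Weighting.
Variables (R : realType) (G : sgraph).

Definition vertex_sum (f : G + edge G -> R) (v : G) : R :=
  f (inl v) + \sum_(e : edge G | v \in val e) f (inr e).

Definition proper_weighting (f : G + edge G -> R) : Prop :=
  forall u v : G, adj u v -> vertex_sum f u <> vertex_sum f v.

Definition choosable (k k' : nat) : Prop :=
  forall L : G + edge G -> {fset R},
    (forall v : G, #|` L (inl v)|%fset = k) ->
    (forall e : edge G, #|` L (inr e)|%fset = k') ->
    exists f : G + edge G -> R,
      (forall z, f z \in L z) /\ proper_weighting f.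

End Weighting.

(* Main.v *)
Require Import Defs.
From mathcomp Require Import all_boot all_order all_algebra reals.
From mathcomp Require Import all_fingroup finmap boolp zify.
Set Implicit Arguments.
Unset Strict Implicit.
Unset Printing Implicit Defensive.
Import Order.TTheory GRing.Theory Num.Theory.
Local Open Scope ring_scope.

(** The column of an edge vw is the sum of the columns of v and w. Delete the
    vertices of G one at a time, keeping a set W of vertices and a set A of
    columns; restricted to the rows of the edges inside W, a column that meets W
    in w only is a further copy of the column of w. When v, of degree d in W, is
    deleted, spend on the d rows at v exactly d columns that all equal the
    column of v there: copies of v, or differences (edge vw) - (copy of w). The
    permanent is then block triangular with a block +-d!, and each difference can
    be replaced by one of its two terms by multilinearity. A neighbour w of v
    loses its edge to v; it also loses a copy if it was used in a difference,
    and otherwise gains one, namely the unused edge vw. Hence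
    (copies of w) - (degree of w) is at least -2 initially, never drops, and grows
    by 2 at the neighbours not used in differences. A vertex where it is
    nonnegative can be deleted without differences, which makes all its
    neighbours such vertices. If there is no such vertex, delete the end v of a
    longest path, using differences at all neighbours but the next vertex u of
    the path: the other neighbours of v lie on the path, so u reaches them in
    W - v. *)

(** * Permanents expanded over sets of rows, and a Ryser-type formula *)

Section SetPermanent.
Variables (R : comNzRingType) (I : finType).
Implicit Types (F : {set I}) (q : I -> R) (Q : seq (I -> R)).

(** Expansion along the first column. With rows as a set and columns as a list of functions, both
    can be removed without renumbering, and a column can be a difference of matrix columns.
    Non-square shapes get the value 0. *)
Fixpoint set_permanent F Q : R :=
  if Q is q :: Q' then \sum_(i in F) q i * set_permanent (F :\ i) Q'
  else (F == set0)%:R.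

Lemma set_permanent_size F Q : set_permanent F Q != 0 -> size Q = #|F|.
Proof.
elim: Q F => [|q Q IH] F /=.
  by case: (altP (F =P set0)) => [-> _|]; rewrite ?cards0 // eqxx.
move=> nz.
have [i /andP[iF inz]] : exists i, (i \in F) && (set_permanent (F :\ i) Q != 0).
  apply/existsP; apply: contraNT nz; rewrite negb_exists => /forallP h.
  rewrite big1 // => i iF; move: (h i); rewrite iF /= negbK => /eqP ->.
  by rewrite mulr0.
by rewrite (IH _ inz) [in RHS](cardsD1 i) iF.
Qed.

Lemma set_permanent_columnB F Q1 Q2 q q1 q2 :
    {in F, forall i, q i = q1 i - q2 i} ->
  set_permanent F (Q1 ++ q :: Q2) =
  set_permanent F (Q1 ++ q1 :: Q2) - set_permanent F (Q1 ++ q2 :: Q2).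
Proof.
elim: Q1 F => [|p Q1 IH] F hq /=; rewrite -sumrB; apply: eq_bigr => i iF.
  by rewrite hq // mulrBl.
by rewrite -mulrBr IH // => j /setD1P[_ /hq].
Qed.

(** If a difference is nonzero, one of its two terms is; this is applied to one column after
    another, [Q1] collecting the columns already chosen. *)
Lemma set_permanent_pick (J : eqType) (s : seq J) (q q1 q2 : J -> I -> R)
    F Q1 Q2 :
    uniq s ->
    {in s, forall w, {in F, forall i, q w i = q1 w i - q2 w i}} ->
    set_permanent F (Q1 ++ [seq q w | w <- s] ++ Q2) != 0 ->
  exists b : pred J, set_permanent F
    (Q1 ++ [seq if b w then q1 w else q2 w | w <- s] ++ Q2) != 0.
Proof.
elim: s Q1 => [|w s IH] Q1 /=; first by exists predT.
case/andP=> ws us hq nz.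
have [c] : exists c : bool, set_permanent F
    (rcons Q1 (if c then q1 w else q2 w) ++ [seq q w | w <- s] ++ Q2) != 0.
  move: nz; rewrite (set_permanent_columnB Q1 _ (hq w (mem_head _ _))).
  set a := set_permanent _ _ => nz.
  have [a0|a0] := eqVneq a 0; [exists false | exists true]; rewrite cat_rcons //.
  by move: nz; rewrite a0 sub0r oppr_eq0.
have hqs : {in s, forall x, {in F, forall i, q x i = q1 x i - q2 x i}}.
  by move=> x xs; apply: hq; rewrite inE xs orbT.
case/(IH _ us hqs) => b.
rewrite cat_rcons => nz'; exists (fun x => if x == w then c else b x).
rewrite eqxx; congr (set_permanent _ (_ ++ _ :: _ ++ _) != 0): nz'.
apply/eq_in_map => x xs; case: eqP => // xw.
by rewrite -xw xs in ws.
Qed.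

(** The columns [Q1] all equal [q], which vanishes off [F1], so they can only be matched with the
    rows of [F1]; each of the [#|F1|!] matchings contributes the same product. *)
Lemma set_permanent_block F F1 Q1 Q2 q :
    F1 \subset F -> size Q1 = #|F1| ->
    {in F :\: F1, forall i, q i = 0} ->
    (forall k, (k < size Q1)%N ->
       {in F, forall i, nth (fun=> 0) Q1 k i = q i}) ->
  set_permanent F (Q1 ++ Q2) =
  (#|F1| `!)%:R * \prod_(i in F1) q i * set_permanent (F :\: F1) Q2.
Proof.
elim: Q1 F F1 => [|q1 Q1 IH] F F1 /= sub sz q0 hq.
  have -> : F1 = set0 by apply/eqP; rewrite -cards_eq0 -sz.
  by rewrite cards0 big_set0 setD0 fact0 !mul1r.
rewrite (eq_bigr (fun i => q i * set_permanent (F :\ i) (Q1 ++ Q2))); last first.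
  by move=> i iF; rewrite -(hq 0%N isT i iF).
rewrite (big_setID F1) /= addrC big1 ?add0r; last first.
  by move=> i iF; rewrite q0 // mul0r.
rewrite (setIidPr sub) (eq_bigr (fun=> ((size Q1)`!)%:R *
    \prod_(i in F1) q i * set_permanent (F :\: F1) Q2)); last first.
  move=> i iF1; have cE : #|F1 :\ i| = size Q1.
    by move: sz; rewrite (cardsD1 i F1) iF1 => -[].
  have FE : (F :\ i) :\: (F1 :\ i) = F :\: F1.
    apply/setP=> j; rewrite !inE; case: (eqVneq j i) => [->|] //=.
    by rewrite iF1.
  rewrite (IH (F :\ i) (F1 :\ i)) ?cE ?FE //.
  - by rewrite (big_setD1 i iF1) /= !mulrA [_ * q i]mulrC.
  - exact: setSD.
  - by move=> k kl j /setD1P[_ jF]; apply: (hq k.+1).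
by rewrite sumr_const -sz factS natrM -!mulrA [RHS]mulr_natl.
Qed.

(** Unfolding the recursion: the tuple [s] is an ordering of [F], giving the row matched with each
    column. *)
Lemma set_permanent_tuple (T : Type) (M : I -> T -> R) k (t : k.-tuple T) F :
  set_permanent F [seq M^~ z | z <- t] =
  \sum_(s : k.-tuple I | perm_eq s (enum F))
     \prod_(j < k) M (tnth s j) (tnth t j).
Proof.
elim: k t F => [|k IH] t F.
  rewrite (tuple0 t) /= (eq_bigr (fun=> 1)); last by move=> s _; rewrite big_ord0.
  rewrite (eq_bigl (fun s => F == set0)); last first.
    move=> s; rewrite (tuple0 s) -cards_eq0 cardE.
    apply/idP/idP => [/perm_size <- //|/nilP -> //].
  case: eqP => _; last by rewrite big_pred0.
  rewrite (big_pred1 [tuple]) // => s; apply/esym/eqP; exact: tuple0.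
case/tupleP: t => z t /=.
have bij : bijective (fun p : I * k.-tuple I => [tuple of p.1 :: p.2]).
  exists (fun s => (thead s, [tuple of behead s])) => [[i s]|s].
    by congr pair; apply: val_inj.
  by rewrite -tuple_eta.
rewrite (reindex _ (onW_bij _ bij)) /=.
rewrite (eq_bigr (fun i => \sum_(s : k.-tuple I | perm_eq s (enum (F :\ i)))
    M i z * \prod_(j < k) M (tnth s j) (tnth t j))); last first.
  by move=> i _; rewrite IH big_distrr.
rewrite pair_big_dep /=; apply: eq_big => [[i s]|[i s] _] /=.
  apply/andP/idP => [[iF ps]|ps].
    apply: (@perm_trans _ (i :: enum (F :\ i))); first by rewrite perm_cons.
    apply: uniq_perm; rewrite /= ?enum_uniq ?mem_enum ?inE ?eqxx //.
    move=> j; rewrite inE !mem_enum !inE.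
    by case: (eqVneq j i) => [->|].
  have iF : i \in F by rewrite -mem_enum -(perm_mem ps) mem_head.
  split=> //; rewrite -(perm_cons i); apply: (perm_trans ps).
  apply: uniq_perm; rewrite /= ?enum_uniq ?mem_enum ?inE ?eqxx //.
  move=> j; rewrite inE !mem_enum !inE.
  by case: (eqVneq j i) => [->|].
rewrite big_ord_recl /= !tnth0; congr (_ * _).
by apply: eq_bigr => j _; rewrite !tnthS.
Qed.

Lemma set_permanentT (T : Type) (M : I -> T -> R) (t : #|I|.-tuple T) :
  set_permanent [set: I] [seq M^~ z | z <- t] =
  permanent (\matrix_(i < #|I|, j < #|I|) M (enum_val i) (tnth t j)).
Proof.
rewrite set_permanent_tuple.
pose h (s : 'S_#|I|) := [tuple enum_val (s j) | j < #|I|].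
(* The default 1 is reached only by tuples with repetitions, which are not orderings of [I]. *)
pose h' (s : #|I|.-tuple I) : 'S_#|I| :=
  insubd (1%g : 'S_#|I|) [ffun j => enum_rank (tnth s j)].
have enT : enum [set: I] =i predT by move=> i; rewrite mem_enum inE.
rewrite (reindex_onto h h') /=; last first.
  move=> s ps; apply: eq_from_tnth => j; rewrite tnth_mktuple.
  have us : uniq s by rewrite (perm_uniq ps) enum_uniq.
  rewrite -[h' s _]/(fun_of_perm (h' s) j) -pvalE val_insubd.
  rewrite ifT ?ffunE ?enum_rankK //.
  apply/injectiveP => j1 j2; rewrite !ffunE => /enum_rank_inj.
  by move/tuple_uniqP: us; apply.
(* Orderings send columns to rows, the permutations in [permanent] send rows to columns; hence the
   inverse. *)
rewrite /permanent [RHS](reindex_inj invg_inj) /=.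
apply: eq_big => [s|s _].
  have -> : perm_eq (h s) (enum [set: I]).
    apply: uniq_perm; rewrite ?enum_uniq //.
      apply/tuple_uniqP => j1 j2; rewrite !tnth_mktuple.
      by move/enum_val_inj/perm_inj.
    move=> i; rewrite enT; apply/tnthP; exists ((s^-1)%g (enum_rank i)).
    by rewrite tnth_mktuple permKV enum_rankK.
  apply/eqP/permP => j.
  rewrite -[h' _ _]/(fun_of_perm (h' (h s)) j) -pvalE val_insubd.
  rewrite ifT ?ffunE ?tnth_mktuple ?enum_valK //.
  apply/injectiveP => j1 j2; rewrite !ffunE !tnth_mktuple !enum_valK.
  exact: perm_inj.
rewrite [RHS](reindex_inj (@perm_inj _ s)) /=; apply: eq_bigr => j _.
by rewrite mxE permK tnth_mktuple.
Qed.

End SetPermanent.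

(* A variant of Ryser's formula: the constants [b] do not matter, since only the
   monomials involving every [e j] survive the alternating sum. *)
Lemma permanent_alternating_sum (R : comNzRingType) (m : nat)
    (b : 'I_m -> R) (B : 'M[R]_m) :
  \sum_(e : {ffun 'I_m -> bool}) (\prod_(j < m) (-1) ^+ e j) *
     \prod_(i < m) (b i + \sum_(j < m) (e j)%:R * B i j) =
  (-1) ^+ m * permanent B.
Proof.
(* Expanding the product chooses a term in each factor: [None] is the constant, [Some j] the term of
   [e j]. *)
pose g i (o : option 'I_m) := if o is Some j then B i j else b i.
pose x (e : {ffun 'I_m -> bool}) o : R := if o is Some j then (e j)%:R else 1.
have sum_option (F : option 'I_m -> R) : \sum_o F o = F None + \sum_j F (Some j).
  rewrite (bigD1 None) //=; congr (_ + _).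
  rewrite (reindex_omap Some id) => [|[]//] /=.
  by apply: eq_bigl => j; rewrite eqxx.
pose h (f : {ffun 'I_m -> option 'I_m}) (j : 'I_m) (c : bool) : R :=
  (-1) ^+ c * (if Some j \in codom f then c%:R else 1).
have hE (f : {ffun 'I_m -> option 'I_m}) (e : {ffun 'I_m -> bool}) :
    (\prod_(j < m) (-1) ^+ e j) * \prod_(i < m) x e (f i) =
    \prod_(j < m) h f j (e j).
  rewrite /h big_split /=; congr (_ * _).
  have [/existsP[j /andP[fj ej]]|] :=
    boolP [exists j, (Some j \in codom f) && ~~ e j].
    rewrite [RHS](bigD1 j) //= fj (negPf ej) mul0r.
    case/codomP: fj => i fi.
    by rewrite (bigD1 i) //= -fi /= (negPf ej) mul0r.
  rewrite negb_exists => /forallP H.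
  rewrite !big1 // => [j _|i _].
    by move: (H j); case: ifP => //= _; rewrite negbK => ->.
  rewrite /x; case fi: (f i) => [j|] //.
  by move: (H j); rewrite -fi codom_f /= negbK => ->.
(* For fixed [f] the sum over [e] factors over [j]: a [j] missed by [f] gives 1 - 1 = 0, a [j] hit
   by [f] forces [e j] and gives -1. *)
have sum_h (f : {ffun 'I_m -> option 'I_m}) :
     \sum_(e : {ffun 'I_m -> bool}) \prod_(j < m) h f j (e j) =
    if [forall j, Some j \in codom f] then (-1) ^+ m else 0.
  rewrite -(bigA_distr_bigA (h f)) /=.
  have hj j : \sum_(c : bool) h f j c = if Some j \in codom f then -1 else 0.
    rewrite (bigD1 true) //= (bigD1 false) //= big1; last by case.
    rewrite /h addr0 expr0 expr1.
    by case: ifP => _; rewrite ?mulr1 ?mulr0 ?addr0 // addNr.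
  rewrite (eq_bigr _ (fun j _ => hj j)).
  case: ifPn => [/forallP H|].
    rewrite (eq_bigr (fun=> -1)) ?prodr_const ?card_ord // => j _.
    by rewrite H.
  by rewrite negb_forall => /existsP[j /negPf fj]; rewrite (bigD1 j) //= fj mul0r.
transitivity (\sum_(f : {ffun 'I_m -> option 'I_m})
    \prod_(i < m) g i (f i) *
      \sum_(e : {ffun 'I_m -> bool}) \prod_(j < m) h f j (e j)).
  rewrite (eq_bigr (fun e : {ffun 'I_m -> bool} => \sum_(f : {ffun 'I_m -> option 'I_m})
      \prod_(i < m) g i (f i) * \prod_(j < m) h f j (e j))) => [|e _]; last first.
    have -> : \prod_(i < m) (b i + \sum_(j < m) (e j)%:R * B i j) =
        \prod_(i < m) \sum_o x e o * g i o.
      by apply: eq_bigr => i _; rewrite sum_option /= mul1r.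
    rewrite bigA_distr_bigA big_distrr /=; apply: eq_bigr => f _.
    by rewrite -hE big_split /= mulrA mulrC.
  by rewrite exchange_big; apply: eq_bigr => f _; rewrite big_distrr.
rewrite (eq_bigr (fun f : {ffun 'I_m -> option 'I_m} =>
   if [forall j, Some j \in codom f] then
     (-1) ^+ m * \prod_(i < m) g i (f i) else 0)); last first.
  by move=> f _; rewrite sum_h; case: ifP => _; rewrite ?mulr0 // mulrC.
rewrite -big_mkcond /= /permanent big_distrr /=.
pose k (s : 'S_m) := [ffun i => Some (s i)].
pose k' (f : {ffun 'I_m -> option 'I_m}) : 'S_m :=
  insubd (1%g : 'S_m) [ffun i => odflt i (f i)].
(* A surviving [f] hits all m columns from m rows, so it never takes [None] and is a permutation. *)
rewrite (reindex_onto k k') /=; last first.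
  move=> f /forallP cf.
  have /fin_all_exists[u uP] j : exists i, f i = Some j.
    by have /codomP[i fi] := cf j; exists i.
  have u_inj : injective u by move=> j1 j2 e12; apply/Some_inj; rewrite -!uP e12.
  have [v uK vK] := injF_bij u_inj.
  have fE i : f i = Some (v i) by rewrite -[i in LHS]vK uP.
  apply/ffunP => i; rewrite ffunE fE; congr Some.
  rewrite -[k' f i]/(fun_of_perm (k' f) i) -pvalE val_insubd.
  rewrite ifT ?ffunE ?fE //.
  apply/injectiveP => i1 i2; rewrite !ffunE !fE /=; exact: can_inj vK i1 i2.
apply: eq_big => [s|s _]; last by congr (_ * _); apply: eq_bigr => i _; rewrite ffunE.
have -> : [forall j, Some j \in codom (k s)].
  apply/forallP => j; apply/codomP; exists ((s^-1)%g j).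
  by rewrite ffunE permKV.
apply/eqP/permP => i.
rewrite -[k' _ _]/(fun_of_perm (k' (k s)) i) -pvalE val_insubd.
rewrite ifT ?ffunE //.
by apply/injectiveP => i1 i2; rewrite !ffunE /=; apply: perm_inj.
Qed.

(** * Maximal paths *)

(** A path ending at [x] is extended at its front while its first vertex has a neighbour off the
    path; its length is bounded by [#|T|]. *)
Lemma maximal_path (T : finType) (e : rel T) (x : T) : symmetric e ->
  exists v p, [/\ path e v p, uniq (v :: p), last v p = x &
                  forall w, e v w -> w \in v :: p].
Proof.
move=> e_sym.
suff H n v p : (#|T| - size p <= n)%N -> path e v p -> uniq (v :: p) ->
    exists v' p', [/\ path e v' p', uniq (v' :: p'), last v' p' = last v p &
      forall w, e v' w -> w \in v' :: p'].
  exact: (H _ x [::]).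
elim: n v p => [|n IH] v p sz pp up.
  by have := max_card (mem (v :: p)); rewrite (card_uniqP up) ltnNge -subn_eq0 -leqn0 sz.
have [/existsP[w /andP[vw wp]]|] := boolP [exists w, e v w && (w \notin v :: p)].
  have [|||v' [p' H]] := IH w (v :: p); last by exists v', p'.
  - by rewrite /= subnS -subn1 leq_subLR add1n.
  - by rewrite /= e_sym vw.
  - by rewrite cons_uniq wp.
rewrite negb_exists => /forallP H; exists v, p; split=> // w vw.
by move: (H w); rewrite vw negbK.
Qed.

(** * The edge matrix on the rows inside a vertex set *)

Section Graph.
Variables (R : numDomainType) (G : sgraph) (o : orientation G).
Implicit Types (W : {set G}) (A : {set G + edge G}) (z : G + edge G).

Definition incident z (v : G) : bool :=
  match z with inl u => u == v | inr e => v \in val e end.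

Arguments incident : simpl never.

Lemma incident_edge (e : edge G) v :
  incident (inr e) v = (v == arc_tail o e) || (v == arc_head o e).
Proof. by rewrite /incident (orientationP o) !inE. Qed.

Lemma incident_edge_inj (e e' : edge G) :
  incident (inr e) =1 incident (inr e') -> e = e'.
Proof. by move=> ee; apply/val_inj/setP => v; apply: ee. Qed.

Lemma edge_of_adj (u v : G) : adj u v ->
  exists e : edge G, incident (inr e) =1 pred2 u v.
Proof.
move=> uv; have ok : [set u; v] \in edge_set G.
  by apply/imsetP; exists (u, v); rewrite ?inE.
by exists (exist (fun e => e \in edge_set G) _ ok) => w; rewrite /incident !inE.
Qed.

Lemma adj_arc (e : edge G) : adj (arc_tail o e) (arc_head o e).
Proof.
have /imsetP[[x y] /= xy eE] := valP e; rewrite inE /= in xy.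
have xNy : x != y by apply: contraTneq xy => ->; rewrite adj_irrefl.
have /setP E : [set arc_tail o e; arc_head o e] = [set x; y].
  by rewrite -orientationP.
have := E (arc_tail o e); have := E (arc_head o e); have := E x; have := E y.
rewrite !inE !eqxx ?orbT /=.
case: (eqVneq (arc_tail o e) x) => [->|_ /=].
  by rewrite eq_sym (negPf xNy) /= => /eqP <-.
by move=> _ + _ /esym/eqP tE; rewrite tE adj_sym => /eqP <-.
Qed.

Lemma arc_tail_neq_head (e : edge G) : arc_tail o e != arc_head o e.
Proof. by apply: contraTneq (adj_arc e) => ->; rewrite adj_irrefl. Qed.

(** The definition excludes [z = inr e], but counting [e] as incident to both of its ends
    contributes 1 - 1 = 0 there, and no other column is incident to both ends. *)
Lemma edge_entryE (e : edge G) z :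
  edge_entry R o e z =
  (incident z (arc_head o e))%:R - (incident z (arc_tail o e))%:R.
Proof.
have th := arc_tail_neq_head e.
have offE v : incident_off e z v = (z != inr e) && incident z v by case: z.
rewrite /edge_entry !offE; have [->|ne] := eqVneq z (inr e).
  by rewrite !incident_edge !eqxx orbT subrr.
case: (boolP (incident z (arc_head o e))) => he;
  case: (boolP (incident z (arc_tail o e))) => te;
  rewrite ?subr0 ?sub0r ?oppr0 //=.
case/eqP: ne; case: z he te {offE} => [u|e' he te].
  by rewrite /incident => /eqP-> /eqP hE; rewrite hE eqxx in th.
congr inr; apply: incident_edge_inj => v; rewrite !incident_edge.
move: he te; rewrite !incident_edge => /orP[]/eqP hE /orP[]/eqP tE.
- by rewrite hE tE eqxx in th.
- by rewrite hE tE orbC.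
- by rewrite hE tE.
- by rewrite hE tE eqxx in th.
Qed.

Definition edges_in W : {set edge G} :=
  [set e | (arc_tail o e \in W) && (arc_head o e \in W)].

Definition nbrs W (v : G) : {set G} := [set u in W | adj v u].

(* On the rows [edges_in W], the column [z] then agrees with that of [w]. *)
Definition acts_as W z (w : G) := [forall u in W, incident z u == (u == w)].

(** The available copies of [w]: for [w] in [W], these are [inl w] and the edges from [w] to
    vertices outside [W], as far as they lie in [A]. *)
Definition own W A (w : G) : {set G + edge G} := [set z in A | acts_as W z w].

Lemma acts_asP W z w :
  reflect {in W, forall u, incident z u = (u == w)} (acts_as W z w).
Proof. exact: eqfun_inP. Qed.

(** Total for convenience; the default is never taken for adjacent [v] and [w]. *)
Definition edge_col (v w : G) : G + edge G :=
  if [pick e : edge G | [forall x, incident (inr e) x == pred2 v w x]] is Some e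
  then inr e else inl v.

Lemma edge_colP v w : adj v w ->
  exists2 e, edge_col v w = inr e & incident (inr e) =1 pred2 v w.
Proof.
case/edge_of_adj => e eE; rewrite /edge_col; case: pickP => [e' /eqfunP|/(_ e)/eqfunP[]//].
by exists e'.
Qed.

Lemma incident_edge_col v w : adj v w -> incident (edge_col v w) =1 pred2 v w.
Proof. by case/edge_colP => e ->. Qed.

Lemma card_star W v : v \in W ->
  #|[set e in edges_in W | incident (inr e) v]| = #|nbrs W v|.
Proof.
move=> vW.
rewrite -(card_imset _ (@inr_inj G (edge G))) -(@card_in_imset _ _ (edge_col v)).
  apply: eq_card => z; apply/imsetP/imsetP => [[e]|[w]]; rewrite !inE.
    move=> /andP[/andP[tW hW]]; rewrite incident_edge => ev ->.
    have ht : (arc_head o e == arc_tail o e) = false.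
      by rewrite eq_sym (negPf (arc_tail_neq_head e)).
    pose w := if v == arc_tail o e then arc_head o e else arc_tail o e.
    have vwE : pred2 v w =1 pred2 (arc_tail o e) (arc_head o e).
      rewrite /w => u /=; case/orP: ev => /eqP->; first by rewrite eqxx.
      by rewrite ht orbC.
    have vw : adj v w.
      rewrite /w; case/orP: ev => /eqP->; first by rewrite eqxx adj_arc.
      by rewrite ht adj_sym adj_arc.
    exists w; first by rewrite inE vw andbT /w; case: ifP.
    have [e' -> e'E] := edge_colP vw; congr inr; apply: incident_edge_inj => u.
    by rewrite e'E vwE incident_edge.
  case/andP=> wW vw ->; have [e -> eE] := edge_colP vw; exists e => //.
  have := eE (arc_tail o e); have := eE (arc_head o e).
  rewrite !incident_edge !eqxx orbT !inE incident_edge.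
  rewrite -!incident_edge eE /= eqxx andbT.
  by move=> /esym/orP[]/eqP-> /esym/orP[]/eqP->; rewrite ?vW ?wW.
move=> w1 w2; rewrite !inE => /andP[_ vw1] /andP[_ vw2] E.
have := incident_edge_col vw1 w1; rewrite E (incident_edge_col vw2) /= eqxx orbT.
by case/orP => /eqP // w1v; rewrite w1v adj_irrefl in vw1.
Qed.

Lemma edge_entry_acts_as W z v e : e \in edges_in W -> acts_as W z v ->
  edge_entry R o e z = (arc_head o e == v)%:R - (arc_tail o e == v)%:R.
Proof.
by rewrite inE => /andP[tW hW] /acts_asP zv; rewrite edge_entryE !zv.
Qed.

(** Incidence with the edge vw is the sum of incidence with [v] and with [w]; subtracting a copy of
    [w] leaves the column of [v]. *)
Lemma edge_entry_edge_col W z v w e : e \in edges_in W -> acts_as W z w ->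
    adj v w ->
  edge_entry R o e (edge_col v w) - edge_entry R o e z =
  (arc_head o e == v)%:R - (arc_tail o e == v)%:R.
Proof.
move=> eW zw vw; rewrite (edge_entry_acts_as eW zw) edge_entryE.
have inc u : (incident (edge_col v w) u)%:R = (u == v)%:R + (u == w)%:R :> R.
  rewrite (incident_edge_col vw) /=; case: (eqVneq u v) => [->|_].
    case: eqP => [wv|_]; last by rewrite addr0.
    by rewrite -wv adj_irrefl in vw.
  by rewrite add0r.
by rewrite !inc opprD addrACA addrK.
Qed.

(** * Deletion of one vertex *)

(** [uniq S] is what makes the permanent index 1; the length of [S] is forced by the nonzero
    permanent. *)
Definition selectable W A := exists S : seq (G + edge G), [/\ uniq S, {subset S <= A} &
  set_permanent (edges_in W) [seq (edge_entry R o)^~ z | z <- S] != 0].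

Definition rep W A w : G + edge G := odflt (inl w) [pick z in own W A w].

Lemma repP W A w : (0 < #|own W A w|)%N -> rep W A w \in own W A w.
Proof.
by case/card_gt0P => z zw; rewrite /rep; case: pickP => [//|/(_ z)]; rewrite zw.
Qed.

(* The columns left after the deletion of [v], with differences at [D]. *)
Definition rest W A v (D : {set G}) : {set G + edge G} :=
  A :\: (own W A v :|: [set rep W A w | w in D] :|: [set edge_col v w | w in D]).

(** A copy of [w] stays a copy when [v] is deleted, and is spent only if it is [rep W A w] with [w]
    in [D]. At a neighbour outside [D] the edge vw becomes a new copy. *)
Lemma card_own_rest W A v (D : {set G}) w :
    v \in W -> D \subset nbrs W v ->
    {in D, forall w, (0 < #|own W A w|)%N} ->
    {in nbrs W v, forall w, edge_col v w \in A} -> w \in W :\ v ->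
  (#|own W A w| + (adj v w && (w \notin D)) <=
   #|own (W :\ v) (rest W A v D) w| + (w \in D))%N.
Proof.
move=> vW Dnb Dpos edgeA wWv; have /setD1P[wv wW] := wWv.
have ownS z : z \in own W A w -> z != rep W A w \/ w \notin D ->
    z \in own (W :\ v) (rest W A v D) w.
  rewrite !inE => /andP[zA zw] zD; rewrite zA andbT; have /acts_asP zwP := zw.
  apply/andP; split; last first.
    by apply/acts_asP => u /setD1P[_ uW]; apply: zwP.
  rewrite !negb_or -!andbA; apply/and3P; split.
  - by apply/acts_asP => zv; have := zwP _ vW; rewrite zv // eqxx eq_sym (negPf wv).
  - apply/imsetP => -[w' w'D zE]; have := repP (Dpos _ w'D).
    rewrite -zE inE => /andP[_ /acts_asP/(_ w wW)]; rewrite zwP // eqxx.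
    move/esym/eqP => ww'; case: zD; first by rewrite zE ww' eqxx.
    by rewrite ww' w'D.
  - apply/imsetP => -[w' w'D zE]; have := subsetP Dnb _ w'D.
    rewrite inE => /andP[_ vw']; have := incident_edge_col vw' v.
    by rewrite -zE zwP //= eqxx eq_sym (negPf wv).
have [wD|wD] := boolP (w \in D).
  rewrite andbF addn0 (cardsD1 (rep W A w)) repP ?Dpos // addn1 ltnS.
  apply/subset_leq_card/subsetP => z /setD1P[zr zo].
  by apply: ownS => //; left.
rewrite andbT addn0; have ownS' : own W A w \subset own (W :\ v) (rest W A v D) w.
  by apply/subsetP => z zo; apply: ownS => //; right.
case: (boolP (adj v w)) => vw; last by rewrite addn0 subset_leq_card.
have inc := incident_edge_col vw.
(* The gain is genuine: before the deletion this column also meets [W] in [v]. *)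
have eN : edge_col v w \notin own W A w.
  rewrite inE; apply/negP => /andP[_ /acts_asP/(_ v vW)].
  by rewrite inc /= eqxx eq_sym (negPf wv).
rewrite addn1 -(add1n #|_|) -[1%N]/(true : nat) -eN -cardsU1.
apply/subset_leq_card; rewrite subUset ownS' andbT sub1set.
have eA : edge_col v w \in A by apply: edgeA; rewrite inE wW.
rewrite !inE eA /= !negb_or -!andbA; apply/and4P; split.
- apply/negP => /acts_asP/(_ w wW); rewrite inc /= eqxx orbT.
  by rewrite (negPf wv).
- apply/imsetP => -[w' w'D zE]; have := repP (Dpos _ w'D).
  rewrite -zE inE => /andP[_ /acts_asP/(_ v vW)]; rewrite inc /= eqxx.
  move/esym/eqP => w'v; have := subsetP Dnb _ w'D.
  by rewrite -w'v inE adj_irrefl andbF.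
- apply/imsetP => -[w' w'D zE]; have := subsetP Dnb _ w'D.
  rewrite inE => /andP[_ vw']; have := inc w.
  rewrite zE (incident_edge_col vw') /= eqxx orbT (negPf wv) => /eqP ww'.
  by rewrite ww' w'D in wD.
- by apply/acts_asP => u /setD1P[uv _]; rewrite inc /= (negPf uv).
Qed.

(** Copies of [v] and differences at [D] fill the rows at [v]; [set_permanent_block] leaves the rows
    of [W :\ v] to the remaining columns, and [set_permanent_pick] turns the differences into
    columns of [A]. *)
Lemma selectable_step W A v (D : {set G}) :
    v \in W -> D \subset nbrs W v ->
    {in D, forall w, (0 < #|own W A w|)%N} ->
    {in nbrs W v, forall w, edge_col v w \in A} ->
    (#|nbrs W v| <= #|own W A v| + #|D|)%N ->
  selectable (W :\ v) (rest W A v D) -> selectable W A.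
Proof.
move=> vW Dnb Dpos edgeA le_nb [S' [uS' S'A nzS']].
pose col z := (edge_entry R o)^~ z.
(* The rows at [v] not accounted for by [D]; [le_nb] provides enough copies. *)
pose B := take (#|nbrs W v| - #|D|) (enum (own W A v)).
have szB : size B = (#|nbrs W v| - #|D|)%N.
  by rewrite size_takel // -cardE leq_subLR addnC.
have BO z : z \in B -> z \in own W A v by move/mem_take; rewrite mem_enum.
pose q (e : edge G) : R := (arc_head o e == v)%:R - (arc_tail o e == v)%:R.
have adjD w : w \in D -> adj v w.
  by move/(subsetP Dnb); rewrite inE => /andP[].
have DW w : w \in D -> w \in W.
  by move/(subsetP Dnb); rewrite inE => /andP[].
have Dv w : w \in D -> w != v.
  by move/adjD; apply: contraTneq => ->; rewrite adj_irrefl.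
pose F1 := [set e in edges_in W | incident (inr e) v].
have F1rest : edges_in W :\: F1 = edges_in (W :\ v).
  apply/setP => e; rewrite !inE incident_edge negb_and negb_or.
  rewrite [v == _]eq_sym [v == arc_head _ _]eq_sym.
  by case: (arc_tail o e \in W); case: (arc_head o e \in W);
    rewrite ?andbF ?andbT.
have nz : set_permanent (edges_in W) ([seq col z | z <- B] ++
    [seq q | w <- enum D] ++ [seq col z | z <- S']) != 0.
  rewrite catA (@set_permanent_block _ _ _ F1 _ _ q).
  (* The block is nonzero: the entries of [q] at these rows are 1 or -1, and factorials do not
     vanish in [R]. *)
  - rewrite F1rest !mulf_neq0 // ?pnatr_eq0 -?lt0n ?fact_gt0 //.
    apply/prodf_neq0 => e; rewrite inE incident_edge => /andP[_ ve].
    have := arc_tail_neq_head e; rewrite /q.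
    case/orP: ve => /eqP <-; rewrite eqxx 1?eq_sym => /negPf->.
      by rewrite sub0r oppr_eq0 oner_eq0.
    by rewrite subr0 oner_eq0.
  - by apply/subsetP => e; rewrite inE => /andP[].
  - rewrite size_cat !size_map szB -cardE card_star // subnK //.
    exact: subset_leq_card.
  - move=> e /setDP[eW]; rewrite inE eW incident_edge negb_or => /andP[].
    by rewrite /q ![v == _]eq_sym => /negPf-> /negPf->; rewrite subrr.
  move=> k; rewrite size_cat !size_map => kl e eW.
  rewrite nth_cat size_map; case: ltnP => [kB|kB].
    rewrite (nth_map (inl v)) //; apply: (edge_entry_acts_as eW).
    by have := BO _ (mem_nth (inl v) kB); rewrite inE => /andP[].
  by rewrite (nth_map v) // ltn_subLR.
case/(@set_permanent_pick _ _ _ _ _ (fun w => col (edge_col v w))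
    (fun w => col (rep W A w))): nz => [|w|b nz]; first exact: enum_uniq.
  rewrite mem_enum => wD e eW; apply/esym/(edge_entry_edge_col eW) => //.
    by have := repP (Dpos _ wD); rewrite inE => /andP[].
  exact: adjD.
pose f w := if b w then edge_col v w else rep W A w.
have fA w : w \in D -> f w \in A.
  move=> wD; rewrite /f; case: (b w); first by rewrite edgeA ?(subsetP Dnb).
  by have := repP (Dpos _ wD); rewrite inE => /andP[].
(* Whichever term is chosen, it meets [W :\ v] in [w] only, so [w] can be recovered from [f w]; this
   gives distinctness. *)
have fE w u : w \in D -> u \in W -> u != v -> incident (f w) u = (u == w).
  move=> wD uW uv; rewrite /f; case: (b w).
    by rewrite (incident_edge_col (adjD _ wD)) /= (negPf uv).
  by have := repP (Dpos _ wD); rewrite inE => /andP[_ /acts_asP]; apply.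
exists (B ++ [seq f w | w <- enum D] ++ S'); split.
- rewrite !cat_uniq take_uniq ?enum_uniq // uS' /= map_inj_in_uniq; last first.
    move=> w1 w2; rewrite !mem_enum => w1D w2D f12; apply/eqP.
    by rewrite -fE ?DW ?Dv // -f12 fE ?eqxx ?DW ?Dv.
  rewrite enum_uniq !andbT; apply/andP; split; apply/hasPn => z.
    rewrite mem_cat => /orP[/mapP[w]|/S'A/setDP[_]].
      rewrite mem_enum => wD ->; apply/negP => /BO; rewrite inE => /andP[_].
      move/acts_asP/(_ w (DW _ wD)); rewrite fE ?DW ?Dv // eqxx.
      by rewrite (negPf (Dv _ wD)).
    rewrite !in_setU !negb_or -!andbA => /and3P[zo _ _].
    by apply: contra zo => /BO.
  case/S'A/setDP => _; rewrite !in_setU !negb_or -!andbA => /and3P[_ z1 z2].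
  apply/mapP => -[w]; rewrite mem_enum => wD zE.
  by move: z1 z2; rewrite zE /f; case: (b w); rewrite imset_f.
- move=> z; rewrite !mem_cat => /or3P[/BO|/mapP[w]|/S'A].
  + by rewrite inE => /andP[].
  + by rewrite mem_enum => wD ->; apply: fA.
  + by case/setDP.
rewrite !map_cat -map_comp; congr (set_permanent _ (_ ++ _ ++ _) != 0): nz.
by apply: eq_map => w; rewrite /= /f; case: (b w).
Qed.

(** Invariant of the deletions: no edge inside the current vertex set has been spent as a column, so
    every difference can be formed. *)
Definition edges_avail W A := {in edges_in W, forall e, inr e \in A}.

Lemma edges_avail_col W A v : edges_avail W A -> v \in W ->
  {in nbrs W v, forall w, edge_col v w \in A}.
Proof.
move=> WA vW w; rewrite inE => /andP[wW /edge_colP[e -> eE]]; apply: WA; rewrite inE.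
have := eE (arc_tail o e); have := eE (arc_head o e).
rewrite !incident_edge !eqxx orbT.
by move=> /esym/orP[]/eqP-> /esym/orP[]/eqP->; rewrite ?vW ?wW.
Qed.

(** Each removed column either is incident to [v] or meets [W] in one vertex only, whereas an edge
    inside [W :\ v] avoids [v] and has two ends in [W]. *)
Lemma edges_avail_rest W A v (D : {set G}) :
    edges_avail W A -> v \in W -> D \subset nbrs W v ->
    {in D, forall w, (0 < #|own W A w|)%N} ->
  edges_avail (W :\ v) (rest W A v D).
Proof.
move=> WA vW Dnb Dpos e; rewrite inE => /andP[/setD1P[tv tW] /setD1P[hv hW]].
have eA : inr e \in A by apply: WA; rewrite inE tW.
have ev : incident (inr e) v = false.
  by rewrite incident_edge ![v == _]eq_sym (negPf tv) (negPf hv).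
rewrite in_setD eA !in_setU !negb_or andbT -andbA; apply/and3P; split.
- by rewrite inE eA; apply/negP => /acts_asP/(_ v vW); rewrite ev eqxx.
- apply/imsetP => -[w wD eE]; have := repP (Dpos _ wD).
  rewrite -eE inE => /andP[_ /acts_asP ew]; have := arc_tail_neq_head e.
  have := ew _ tW; have := ew _ hW.
  rewrite !incident_edge !eqxx orbT.
  by move=> /esym/eqP-> /esym/eqP->; rewrite eqxx.
apply/imsetP => -[w wD eE]; have := subsetP Dnb _ wD.
by rewrite inE => /andP[_ vw]; have := incident_edge_col vw v; rewrite -eE ev /= eqxx.
Qed.

Lemma card_nbrs_setD1 W v w : v \in W ->
  #|nbrs W w| = (adj v w + #|nbrs (W :\ v) w|)%N.
Proof.
move=> vW; rewrite (cardsD1 v) inE vW adj_sym; congr (_ + #|pred_of_set _|)%N.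
by apply/setP => u; rewrite !inE andbA.
Qed.

(** * Induction on the vertex set *)

Definition linked W : rel G := [rel a b | [&& adj a b, a \in W & b \in W]].

Lemma linked_sym W : symmetric (linked W).
Proof. by move=> a b; rewrite /linked /= adj_sym [(a \in W) && _]andbC. Qed.

(** The third hypothesis keeps the induction going: a vertex may run out of copies only if its
    component in [W] contains a vertex with at least as many copies as neighbours. *)
Lemma selectable_of_weights W A :
    edges_avail W A ->
    {in W, forall w, (#|nbrs W w| <= #|own W A w| + 2)%N} ->
    {in W, forall w, (0 < #|own W A w|)%N \/
      exists x, [/\ connect (linked W) w x, x \in W &
                    (#|nbrs W x| <= #|own W A x|)%N]} ->
  selectable W A.
Proof.
have [n] := ubnP #|W|; elim: n W A => // n IH W A Wn WA deg2 pos.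
have [W0|[w0 w0W]] := set_0Vmem W.
  exists [::]; split=> //=; rewrite (_ : edges_in W = set0) ?eqxx ?oner_eq0 //.
  by apply/setP => e; rewrite W0 !inE.
(* Only the third hypothesis for [W :\ v] depends on how [v] and [D] are chosen. *)
have step v (D : {set G}) : v \in W -> D \subset nbrs W v ->
    {in D, forall w, (0 < #|own W A w|)%N} ->
    (#|nbrs W v| <= #|own W A v| + #|D|)%N ->
    ({in W :\ v, forall w, #|own W A w| + (adj v w && (w \notin D)) <=
       #|own (W :\ v) (rest W A v D) w| + (w \in D)}%N ->
     {in W :\ v, forall w, (0 < #|own (W :\ v) (rest W A v D) w|)%N \/
      exists x, [/\ connect (linked (W :\ v)) w x, x \in W :\ v &
        (#|nbrs (W :\ v) x| <= #|own (W :\ v) (rest W A v D) x|)%N]}) ->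
    selectable W A.
  move=> vW Dnb Dpos le_nb pos'.
  have edgeA := edges_avail_col WA vW.
  have le_own w := @card_own_rest W A v D w vW Dnb Dpos edgeA.
  apply: (selectable_step vW Dnb) => //; apply: IH.
  - by move: Wn; rewrite (cardsD1 v) vW.
  - exact: edges_avail_rest.
  - move=> w wW'; have /setD1P[_ wW] := wW'.
    have Dadj : w \in D -> adj v w.
      by move/(subsetP Dnb); rewrite inE => /andP[].
    have := le_own w wW'; have := deg2 w wW; rewrite (card_nbrs_setD1 _ vW).
    by case: (w \in D) Dadj => [->//|_]; case: (adj v w) => /=; lia.
  - exact: pos'.
have [/existsP[v /andP[vW rv]]|] :=
    boolP [exists v, (v \in W) && (#|nbrs W v| <= #|own W A v|)%N].
  apply: (step v set0) => //; rewrite ?sub0set ?cards0 ?addn0 //.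
    by move=> w; rewrite inE.
  move=> le_own w wW'; have /setD1P[wv wW] := wW'.
  have le_own' x (xW' : x \in W :\ v) :
      (#|own W A x| + adj v x <= #|own (W :\ v) (rest W A v set0) x|)%N.
    by have := le_own x xW'; rewrite inE andbT addn0.
  have [own_w|[x [/connectP[p pw ->] xW rx]]] := pos w wW.
    by left; apply: leq_trans own_w (leq_trans (leq_addr _ _) (le_own' w wW')).
  (* Follow the path from [w] to [x]. If it enters [v], the vertex just before gained a copy and
     lost a neighbour, and so takes over the role of [x]. *)
  right; elim: p w wv wW wW' pw xW rx => [|y p IHp] w wv wW wW' /=.
    move=> _ _ rw; exists w; split=> //; have := le_own' w wW'.
    by move: rw; rewrite (card_nbrs_setD1 _ vW); case: (adj v w) => /=; lia.
  case/andP=> /and3P[wy _ yW] py xW rx; have [yv|yv] := eqVneq y v.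
    exists w; split=> //; have := le_own' w wW'; have := deg2 w wW.
    have vw : adj v w by rewrite -yv adj_sym.
    by rewrite (card_nbrs_setD1 _ vW) vw /=; lia.
  have yW' : y \in W :\ v by rewrite !inE yv.
  have [z [yz zW' rz]] := IHp y yv yW yW' py xW rx; exists z; split=> //.
  by apply: connect_trans (connect1 _) yz; rewrite /linked /= wy wW'.
rewrite negb_exists => /forallP no_rem.
have stuck x : x \in W -> (#|own W A x| < #|nbrs W x|)%N.
  by move=> xW; move: (no_rem x); rewrite xW -ltnNge.
have pos1 w : w \in W -> (0 < #|own W A w|)%N.
  by move=> wW; case: (pos w wW) => // -[x [_ /stuck]]; rewrite ltnNge => /negPf->.
have [v [p [vp uvp lvp max_v]]] := maximal_path w0 (@linked_sym W).
have vW : v \in W.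
  by case: p vp lvp {uvp max_v} => [_ /= ->|u p /andP[/and3P[]]].
have nb_p w : w \in nbrs W v -> w \in p.
  rewrite inE => /andP[wW vw]; have := max_v w; rewrite /linked /= vw vW wW => /(_ isT).
  by rewrite inE => /predU1P[wv|//]; rewrite wv adj_irrefl in vw.
(* The path has a second vertex [u]: by [stuck], [v] has a neighbour, and it lies on the path. *)
case: p vp uvp nb_p {lvp max_v} => [_ _ nb_p|u p /= /andP[/and3P[vu _ uW] up]].
  have /card_gt0P[w /nb_p] : (0 < #|nbrs W v|)%N by apply: leq_trans (stuck v vW).
  by [].
case/andP=> v_up _ nb_p.
have uN : u \in nbrs W v by rewrite inE uW.
have nbE := cardsD1 u (nbrs W v); rewrite uN /= in nbE.
(* All neighbours but [u] are used in differences, so a single copy of [v] is enough. *)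
apply: (step v (nbrs W v :\ u)) => //.
- exact: subD1set.
- by move=> w; rewrite !inE => /and3P[_ wW _]; apply: pos1.
- by have := pos1 v vW; lia.
move=> le_own w wW'; have /setD1P[wv wW] := wW'.
have uv : u != v by apply: contraTneq vu => ->; rewrite adj_irrefl.
have uW' : u \in W :\ v by rewrite !inE uv.
have ru : (#|nbrs (W :\ v) u| <= #|own (W :\ v) (rest W A v (nbrs W v :\ u)) u|)%N.
  have := le_own u uW'; have := deg2 u uW.
  rewrite (card_nbrs_setD1 _ vW) vu setD11 addn0; clear; lia.
have [vw|vw] := boolP (adj v w); last first.
  have wND : (w \in nbrs W v :\ u) = false by rewrite !inE (negPf vw) !andbF.
  left; have := le_own w wW'; rewrite wND (negPf vw) !addn0.
  exact: leq_trans (pos1 w wW).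
(* A neighbour of [v] may have lost its last copy, but the path joins it to [u] without passing
   through [v]. *)
right; exists u; split=> //; rewrite (sym_connect_sym (@linked_sym _)).
apply: path_connect (nb_p w _); last by rewrite inE wW.
elim: p u up v_up {uN nbE le_own uv uW' ru vu nb_p uW} => //= y p IHp u.
case/andP=> /and3P[uy uW yW] py; rewrite !inE !negb_or => /and3P[vu vy vp].
rewrite /linked /= uy !inE uW yW ![_ == v]eq_sym vu vy /=; apply: IHp => //.
by rewrite inE negb_or vy.
Qed.

End Graph.

(** * Subcubic graphs and the permanent index *)

Section Subcubic.
Variables (R : numDomainType) (G : sgraph) (o : orientation G).

(** Initially each vertex has its own column as a copy, and degree at most 3 = 1 + 2. *)
Lemma subcubic_selectable : subcubic G -> selectable R o [set: G] setT.
Proof.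
move=> subG.
have own_gt0 w : (0 < #|own [set: G] [set: G + edge G] w|)%N.
  apply/card_gt0P; exists (inl w); rewrite !inE /=.
  by apply/acts_asP => u _; rewrite eq_sym.
apply: selectable_of_weights => [e _|w _|w _]; [exact: in_setT | | by left].
apply: (@leq_trans 3); last by have := own_gt0 w; lia.
have -> : nbrs [set: G] w = [set u | adj w u] by apply/setP => u; rewrite !inE.
exact: leq_trans (@leq_bigmax _ (@degree G) w) subG.
Qed.

Lemma subcubic_columns : subcubic G ->
  exists2 t : #|{: edge G}|.-tuple (G + edge G), uniq t &
    permanent (\matrix_(i < #|{: edge G}|, j < #|{: edge G}|)
      edge_entry R o (enum_val i) (tnth t j)) != 0.
Proof.
case/subcubic_selectable => S [uS _]; rewrite (_ : edges_in o _ = [set: edge G]).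
  move=> nz; have := set_permanent_size nz; rewrite size_map cardsT => /eqP szS.
  exists (Tuple szS) => //; rewrite -(set_permanentT (edge_entry R o)).
  exact: nz.
by apply/setP => e; rewrite !inE.
Qed.

Lemma subcubic_pind : subcubic G -> pind (edge_matrix R o) = Some 1%N.
Proof.
case/subcubic_columns => t ut nz.
have le1 : pind_le (edge_matrix R o) 1.
  exists (fun j => enum_rank (tnth t j)); split.
    apply/eqP; apply: contraNneq nz => <-; apply/eqP; congr permanent.
    by apply/matrixP => i j; rewrite !mxE enum_rankK.
  move=> j; apply/card_le1_eqP => i1 i2; rewrite !inE => /eqP<- /eqP.
  by move/enum_rank_inj; move/tuple_uniqP: ut; apply.
rewrite /pind; case: pselect => [ex|[]]; last by exists 1%N; apply/asboolP.
case: ex_minnP => -[|k] //= _ /(_ 1%N) /=.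
by rewrite asboolT // => /(_ isT); case: k.
Qed.

End Subcubic.

(** * From a nonzero permanent to proper weightings *)

Lemma orientation_exists (G : sgraph) : inhabited (orientation G).
Proof.
have /choice[f fP] (e : edge G) : exists xy : G * G, val e = [set xy.1; xy.2].
  by have /imsetP[xy _ eE] := valP e; exists xy.
exact: inhabits (Orientation fP).
Qed.

Section Weights.
Variables (R : realType) (G : sgraph) (o : orientation G).

Lemma vertex_sumE (f : G + edge G -> R) v :
  vertex_sum f v = \sum_z (incident z v)%:R * f z.
Proof.
rewrite big_sumType /= /vertex_sum; congr (_ + _).
  rewrite (bigD1 v) //= /incident eqxx mul1r big1 ?addr0 // => u /negPf->.
  by rewrite mul0r.
rewrite big_mkcond; apply: eq_bigr => e _.
by rewrite /incident; case: ifP => _; rewrite ?mul1r ?mul0r.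
Qed.

(** The edge matrix applied to a weighting: the weighting is proper when every entry of the result
    is nonzero. *)
Lemma vertex_sum_arc (f : G + edge G -> R) e :
  vertex_sum f (arc_head o e) - vertex_sum f (arc_tail o e) =
  \sum_z edge_entry R o e z * f z.
Proof.
rewrite !vertex_sumE -sumrB; apply: eq_bigr => z _.
by rewrite edge_entryE mulrBl.
Qed.

(** A Nullstellensatz argument for lists of size 2: let the weights at [t] switch between two listed
    values and fix the others. The product of all differences along edges is a product of affine
    forms in the switches, whose alternating sum is a nonzero permanent up to sign. *)
Lemma choosable_of_columns (t : #|{: edge G}|.-tuple (G + edge G)) :
    uniq t ->
    permanent (\matrix_(i < #|{: edge G}|, j < #|{: edge G}|)
      edge_entry R o (enum_val i) (tnth t j)) != 0 ->
  choosable R G 2 2.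
Proof.
move=> ut nz L Lv Le.
have /choice[ab abL] z : exists p : R * R, [/\ p.1 \in L z, p.2 \in L z & p.1 != p.2].
  have L2 : #|` L z|%fset = 2 by case: z.
  have /fset0Pn[a aL] : L z != fset0 by rewrite -cardfs_gt0 L2.
  have /fset0Pn[b] : (L z `\ a)%fset != fset0.
    by rewrite -cardfs_gt0 -(ltn_add2l (a \in L z)) -cardfsD1 L2 aL.
  by rewrite !inE => /andP[ba bL]; exists (a, b); split; rewrite // eq_sym.
pose m := #|{: edge G}|.
(* Each column is scaled by the gap between its two values, which multiplies the permanent by the
   nonzero product of the gaps. *)
pose B : 'M[R]_m := \matrix_(i, j) (edge_entry R o (enum_val i) (tnth t j) *
   ((ab (tnth t j)).2 - (ab (tnth t j)).1)).
pose c (i : 'I_m) := \sum_z edge_entry R o (enum_val i) z * (ab z).1.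
have nzB : permanent B != 0.
  rewrite (_ : permanent B = permanent (\matrix_(i < m, j < m)
      edge_entry R o (enum_val i) (tnth t j)) *
      \prod_(j < m) ((ab (tnth t j)).2 - (ab (tnth t j)).1)).
    rewrite mulf_neq0 //; apply/prodf_neq0 => j _; rewrite subr_eq0 eq_sym.
    by have [] := abL (tnth t j).
  rewrite /permanent big_distrl /=; apply: eq_bigr => s _.
  rewrite [X in _ * X](reindex_inj (@perm_inj _ s)) -big_split /=.
  by apply: eq_bigr => i _; rewrite !mxE.
pose f (e : {ffun 'I_m -> bool}) z : R :=
  if [exists j, (tnth t j == z) && e j] then (ab z).2 else (ab z).1.
(* As [t] has no repetition, each of its entries is governed by exactly one switch. *)
have fE e j : f e (tnth t j) =
    (ab (tnth t j)).1 + (e j)%:R * ((ab (tnth t j)).2 - (ab (tnth t j)).1).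
  rewrite /f (_ : [exists k, _] = e j); last first.
    apply/existsP/idP => [[k /andP[/eqP kj]]|ej]; last by exists j; rewrite eqxx.
    by move/tuple_uniqP: ut => /(_ _ _ kj) ->.
  by case: (e j); rewrite ?mul1r ?mul0r ?addr0 // addrC subrK.
have diffE e i : vertex_sum (f e) (arc_head o (enum_val i)) -
    vertex_sum (f e) (arc_tail o (enum_val i)) =
    c i + \sum_(j < m) (e j)%:R * B i j.
  rewrite vertex_sum_arc /c.
  rewrite [X in _ + X](_ : _ = \sum_(j < m) edge_entry R o (enum_val i) (tnth t j) *
      (f e (tnth t j) - (ab (tnth t j)).1)); last first.
    by apply: eq_bigr => j _; rewrite fE addrAC subrr add0r mxE mulrCA.
  rewrite -(big_tuple _ _ t predT
    (fun z => edge_entry R o (enum_val i) z * (f e z - (ab z).1))) /=.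
  rewrite [X in _ = _ + X]big_uniq // [X in _ = _ + X]big_mkcond -big_split /=.
  apply: eq_bigr => z _; case: ifPn => [_|zt].
    by rewrite mulrBr addrC subrK.
  rewrite addr0 /f ifN //; apply/existsPn => j; rewrite negb_and.
  by apply/orP; left; apply: contraNneq zt => <-; apply: mem_tnth.
have [e nze] : exists e : {ffun 'I_m -> bool},
    \prod_(i < m) (c i + \sum_(j < m) (e j)%:R * B i j) != 0.
  apply/existsP; apply: contraNT nzB => /existsPn H.
  have := permanent_alternating_sum c B.
  rewrite big1 => [/esym/eqP|e _]; first by rewrite mulf_eq0 signr_eq0.
  by move: (H e); rewrite negbK => /eqP->; rewrite mulr0.
exists (f e); split=> [z|u v uv].
  by rewrite /f; have [] := abL z; case: ifP.
have [a aE] := edge_of_adj uv.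
have : vertex_sum (f e) (arc_head o a) != vertex_sum (f e) (arc_tail o a).
  rewrite -subr_eq0; move/prodf_neq0: nze => /(_ (enum_rank a) isT).
  by rewrite -diffE enum_rankK.
have := arc_tail_neq_head o a; have := aE (arc_tail o a); have := aE (arc_head o a).
rewrite !(incident_edge o) !eqxx orbT /=.
move=> /esym/orP[]/eqP-> /esym/orP[]/eqP->; rewrite ?eqxx // => _ /eqP//.
by move=> ne /esym.
Qed.

End Weights.

Theorem corollary2 (R : realType) (G : sgraph) (hG : subcubic G) :
  (forall o : orientation G, pind (edge_matrix R o) = Some 1%N) /\
  choosable R G 2 2.
Proof.
split=> [o|]; first exact: subcubic_pind.
have [o] := orientation_exists G.
have [t ut nz] := subcubic_columns R o hG.
exact: choosable_of_columns ut nz.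
Qed.
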